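(* Let $(\varOmega,\mathfrak{A},\mathbb{P})$ be a complete probability space, let $\mathbb{X}\subset\mathbb{R}^n$ be a Borel set, and let $x:\varOmega\to\mathbb{X}$ be an integrable random variable having a probability density function $\pi$ with respect to Lebesgue measure on $\mathbb{X}$ (the prior). Let $X^d$ be the measurement induced random set $X^d(\omega)=\{y\in\mathbb{X}\mid h(y)+\epsilon(\omega)\in\mathcal{Z}\}$, where $h$ is the computational model defined on $\mathbb{X}$, $\epsilon(\omega)$ is a random variable (the measurement noise) and $\mathcal{Z}$ is the observed set. Assume that $X^d$ is an integrally bounded random set, that $X^d(\omega)=\mathrm{cl}\{\mathrm{int}(X^d(\omega))\}$ almost surely, that $x$ and $X^d$ are independent, and that $\mathbb{P}(\{\omega\mid x(\omega)\in X^d(\omega)\})>0$. Define the posterior $$x^a(\omega)=\begin{cases}x(\omega) & \text{if } x(\omega)\in X^d(\omega),\\ \emptyset & \text{otherwise,}\end{cases}$$ regarded as a random variable on $(\varOmega,\mathfrak{A},\mathbb{P}^a)$, where $$\mathbb{P}^a(\mathrm{d}\omega)=\frac{\mathbf{1}(x^a(\omega)\neq\emptyset)\,\mathbb{P}(\mathrm{d}\omega)}{\int_{\varOmega}\mathbf{1}(x^a(\omega)\neq\emptyset)\,\mathbb{P}(\mathrm{d}\omega)} .$$ Then $x^a$ has, under $\mathbb{P}^a$, the probability density function $$\pi^a(y)=\frac{\pi(y)\,\mathcal{L}(y)}{\int_{\mathbb{X}}\pi(y')\,\mathcal{L}(y')\,\mathrm{d}y'},\qquad y\in\mathbb{X},$$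 where the likelihood function $\mathcal{L}$ is $$\mathcal{L}(y)=\int_{\varOmega}\mathbf{1}_{X^d(\omega)}(y)\,\mathbb{P}(\mathrm{d}\omega).$$
   Context: A random set is a measurable map $X:\varOmega\to\mathfrak{X}$, where $\mathfrak{X}$ is the family of (relatively) closed subsets of $\mathbb{X}$; measurability means $\{\omega\mid X(\omega)\cap G\neq\emptyset\}\in\mathfrak{A}$ for every relatively open $G\subset\mathbb{X}$, and independence of random sets (or of a random variable and a random set) is with respect to the $\sigma$-algebra on $\mathfrak{X}$ generated by the families $\{F\in\mathfrak{X}\mid F\cap G\neq\emptyset\}$. A random set $X$ is integrally bounded if $\mathbb{E}\bigl(\sup_{y\in X(\omega)}\|y\|\bigr)<\infty$ (with supremum $0$ over the empty set). $\mathrm{int}$ denotes the interior in $\mathbb{R}^n$ and $\mathrm{cl}$ the closure in $\mathbb{X}$. $\mathbf{1}(\cdot)$ equals $1$ if the condition in brackets is true and $0$ otherwise, and $\mathbf{1}_{\mathcal{X}}(y)=\mathbf{1}(y\in\mathcal{X})$. The symbol $\emptyset$ as a value of $x^a$ means that $x^a$ is undefined there; the set of such $\omega$ has $\mathbb{P}^a$-measure zero. *)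

(* Defs.v *)
From HB Require Import structures.
From mathcomp Require Import all_boot all_order all_algebra.
From mathcomp Require Import all_classical all_reals all_analysis.

Set Implicit Arguments.
Unset Strict Implicit.
Unset Printing Implicit Defensive.

Import Order.TTheory GRing.Theory Num.Theory.
Import numFieldNormedType.Exports.

Local Open Scope classical_set_scope.
Local Open Scope ring_scope.

Section borel_rV.
Context (R : realType) (n : nat).

Definition borel_rV : set (set 'rV[R]_n) := <<s [set U | open U] >>.

Let borel0 : borel_rV set0. Proof. exact: sigma_algebra0. Qed.

Let borelC A : borel_rV A -> borel_rV (~` A).
Proof. by move=> sA; rewrite -setTD; exact: sigma_algebraCD. Qed.

Let borel_bigcup (F : (set 'rV[R]_n)^nat) :
  (forall i, borel_rV (F i)) -> borel_rV (\bigcup_i F i).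
Proof. exact: sigma_algebra_bigcup. Qed.

HB.instance Definition _ := @isMeasurable.Build
  (sigma_display [set U : set 'rV[R]_n | open U]) 'rV[R]_n
  borel_rV borel0 borelC borel_bigcup.

Lemma open_measurable_rV (U : set 'rV[R]_n) : open U -> measurable U.
Proof. by move=> oU; exact: sub_sigma_algebra. Qed.

Lemma measurable_fun_rV_open d (T : measurableType d) (f : T -> 'rV[R]_n) :
  (forall U, open U -> measurable (f @^-1` U)) -> measurable_fun setT f.
Proof.
move=> mf; apply: (measurability [set U : set 'rV[R]_n | open U]) => //.
by move=> _ [U oU <-]; rewrite setTI; exact: mf.
Qed.

Lemma open_rV_countable (U : set 'rV[R]_n) : open U ->
  U = \bigcup_(p in [set p : 'rV[rat]_n * nat |
       ball (map_mx ratr p.1 : 'rV[R]_n) (p.2.+1%:R^-1) `<=` U])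
      ball (map_mx ratr p.1 : 'rV[R]_n) (p.2.+1%:R^-1).
Proof.
move=> oU; apply/seteqP; split => [y Uy|y [p /= sub]]; last exact: sub.
have /nbhs_ballP[e /= e0 eU] : nbhs y U by exact: open_nbhs_nbhs.
have [k ke] : exists k : nat, k.+1%:R^-1 < e / 2.
  have e20 : 0 < e / 2 by rewrite divr_gt0.
  exists (Num.truncn (e / 2)^-1).
  by rewrite invf_plt ?posrE// truncnS_gt.
have rat_near (i : 'I_n) :
    exists q : rat, y ord0 i < ratr q < y ord0 i + k.+1%:R^-1.
  have [|q qy] := @rat_in_itvoo R (y ord0 i) (y ord0 i + k.+1%:R^-1).
    by rewrite ltrDl invr_gt0.
  by exists q; rewrite in_itv /= in qy.
have /choice[q qP] := rat_near.
have yball : ball (map_mx ratr (\row_i q i) : 'rV[R]_n) (k.+1%:R^-1) y.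
  split=> [|i j]; first by rewrite invr_gt0.
  rewrite /ball/= !mxE !ord1 ltr_distl; have /andP[q1 q2] := qP j.
  by rewrite q2 andbT ltrBlDr (lt_trans q1)// ltrDl invr_gt0.
exists (\row_i q i, k) => //= z zb; apply: eU.
rewrite (splitr e).
apply: (@ball_triangle _ _ (map_mx ratr (\row_i q i) : 'rV[R]_n)).
  by apply: (le_ball (ltW ke)); exact: ball_sym.
exact: (le_ball (ltW ke)).
Qed.

End borel_rV.

Lemma product_sigma_finite d1 d2 (T1 : measurableType d1)
    (T2 : measurableType d2) (R : realType)
    (m1 : {sigma_finite_measure set T1 -> \bar R})
    (m2 : {sigma_finite_measure set T2 -> \bar R}) :
  sigma_finite setT (m1 \x m2)%E.
Proof.
have /sigma_finiteP[F [TF ndF Foo]] := sigma_finiteT m1.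
have /sigma_finiteP[G [TG ndG Goo]] := sigma_finiteT m2.
exists (fun n => F n `*` G n).
  rewrite -setXTT TF TG predeqE => -[x y]; split.
    move=> [/= [n _ Fnx] [k _ Gky]]; exists (maxn n k) => //; split.
    - by move: x Fnx; exact/subsetPset/ndF/leq_maxl.
    - by move: y Gky; exact/subsetPset/ndG/leq_maxr.
  by move=> [n _ []/= ? ?]; split; exists n.
move=> k; have [? ?] := Foo k; have [? ?] := Goo k.
split; first exact: measurableX.
by rewrite product_measure1E// lte_mul_pinfty// ge0_fin_numE.
Qed.

Section lebesgue_rV.
Context (R : realType).
Implicit Types n : nat.

Definition cons_rV n (p : measurableTypeR R * 'rV[R]_n) : 'rV[R]_n.+1 :=
  \row_j if unlift ord0 j is Some k then p.2 ord0 k else p.1.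

Definition uncons_rV n (v : 'rV[R]_n.+1) : measurableTypeR R * 'rV[R]_n :=
  (v ord0 ord0, \row_j v ord0 (lift ord0 j)).

Lemma cons_rV0 n p i : @cons_rV n p i ord0 = p.1.
Proof. by rewrite mxE unlift_none. Qed.

Lemma cons_rVS n p i j : @cons_rV n p i (lift ord0 j) = p.2 i j.
Proof. by rewrite mxE (ord1 i) liftK. Qed.

Lemma uncons_rV2 n (v : 'rV[R]_n.+1) i j :
  (uncons_rV v).2 i j = v i (lift ord0 j).
Proof. by rewrite mxE (ord1 i). Qed.

Lemma cons_rVK n : cancel (@cons_rV n) (@uncons_rV n).
Proof.
move=> [t v]; rewrite /uncons_rV cons_rV0; congr pair.
by apply/rowP => j; rewrite mxE cons_rVS.
Qed.

Lemma uncons_rVK n : cancel (@uncons_rV n) (@cons_rV n).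
Proof.
move=> v; apply/rowP => j; have [k ->|->] := unliftP ord0 j.
  by rewrite cons_rVS mxE.
by rewrite cons_rV0.
Qed.

Lemma measurable_cons_rV n : measurable_fun setT (@cons_rV n).
Proof.
apply: measurable_fun_rV_open => U /open_rV_countable ->.
rewrite preimage_bigcup bigcup_mkcond.
apply: countable_bigcupT_measurable => [|[q k]]; first exact: countableP.
case: ifPn => // _ /=.
set c : 'rV[R]_n.+1 := map_mx _ _; set e := _^-1.
have -> : @cons_rV n @^-1` ball c e =
    ball (uncons_rV c).1 e `*` ball (uncons_rV c).2 e.
  apply/seteqP; split => [p [e0 pb]|p [pb1 [e0 pb2]]]; split => /=.
  - by have := pb ord0 ord0; rewrite cons_rV0.
  - split => // i j; have := pb i (lift ord0 j).
    by rewrite cons_rVS uncons_rV2.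
  - exact: e0.
  - move=> i j; have [l ->|->] := unliftP ord0 j.
      by have := pb2 i l; rewrite cons_rVS uncons_rV2.
    by rewrite cons_rV0 (ord1 i).
apply: measurableX; last first.
  apply: open_measurable_rV.
  exact: ball_open.
exact: measurable_realfun.measurable_ball.
Qed.

Lemma measurable_coord_rV n (i : 'I_n) :
  measurable_fun setT (fun v : 'rV[R]_n => v ord0 i : measurableTypeR R).
Proof.
apply: (measurability _ (measurable_realfun.RGenOpens.measurableE R)).
move=> _ [_ [a [b ->]] <-]; rewrite setTI; apply: open_measurable_rV.
by apply: open_comp => [v _|]; [exact: coord_continuous|exact: interval_open].
Qed.

Lemma measurable_uncons_rV n : measurable_fun setT (@uncons_rV n).
Proof.
apply: measurable_fun_pair; first exact: measurable_coord_rV.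
apply: measurable_fun_rV_open => U oU; apply: open_measurable_rV.
apply: open_comp oU => v _ /=.
move=> A /nbhs_ballP[e e0 eA]; apply/nbhs_ballP; exists e => //= w [_ vw].
by apply: eA; split=> // i j; rewrite !mxE; exact: vw.
Qed.

Section prepend.
Context n (mu : {sigma_finite_measure set 'rV[R]_n -> \bar R}).

Definition prepend_lebesgue : set 'rV[R]_n.+1 -> \bar R :=
  pushforward (@lebesgue_measure R \x mu)%E (@cons_rV n).

Let prepend0 : prepend_lebesgue set0 = 0%E.
Proof. by rewrite /prepend_lebesgue /pushforward preimage_set0 measure0. Qed.

Let prepend_ge0 A : (0 <= prepend_lebesgue A)%E.
Proof. rewrite /prepend_lebesgue /pushforward; exact: measure_ge0. Qed.

Let measurable_preimage_cons (A : set 'rV[R]_n.+1) :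
  measurable A -> measurable (@cons_rV n @^-1` A).
Proof. by move=> mA; rewrite -[X in measurable X]setTI; exact: measurable_cons_rV. Qed.

Let prepend_sigma_additive : semi_sigma_additive prepend_lebesgue.
Proof.
move=> F mF tF mUF; rewrite /prepend_lebesgue /pushforward preimage_bigcup.
apply: measure_semi_sigma_additive.
- by move=> i; exact: measurable_preimage_cons.
- apply/trivIsetP => /= i j _ _ ij; rewrite -preimage_setI.
  by move/trivIsetP : tF => /(_ _ _ _ _ ij) ->//; rewrite preimage_set0.
- by rewrite -preimage_bigcup; exact: measurable_preimage_cons.
Qed.

HB.instance Definition _ := isMeasure.Build _ _ _ prepend_lebesgue
  prepend0 prepend_ge0 prepend_sigma_additive.

Let prepend_sigma_finite : sigma_finite setT prepend_lebesgue.
Proof.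
have [F FT Ffin] : sigma_finite setT (@lebesgue_measure R \x mu)%E.
  exact: product_sigma_finite.
exists (fun i => @uncons_rV n @^-1` F i) => [|i].
  by rewrite -preimage_bigcup -FT preimage_setT.
split; first by rewrite -[X in measurable X]setTI;
  apply: measurable_uncons_rV => //; exact: (Ffin i).1.
rewrite /prepend_lebesgue /pushforward -comp_preimage.
rewrite (_ : @uncons_rV n \o @cons_rV n = id) ?preimage_id; first exact: (Ffin i).2.
by apply/funext => p /=; rewrite cons_rVK.
Qed.

HB.instance Definition _ :=
  Measure_isSigmaFinite.Build _ _ _ prepend_lebesgue prepend_sigma_finite.

End prepend.

(* A measure on the Borel sigma-algebra, not completed (like lebesgue_measure on
   R); lebesgue_rV_box gives its values on boxes. *)
Fixpoint lebesgue_rV n : {sigma_finite_measure set 'rV[R]_n -> \bar R} :=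
  if n is m.+1 then prepend_lebesgue (lebesgue_rV m) else \d_(0 : 'rV[R]_0).

Lemma measurable_box_rV n (A : 'I_n -> set (measurableTypeR R)) :
  (forall i, measurable (A i)) ->
  measurable [set v : 'rV[R]_n | forall i, A i (v ord0 i)].
Proof.
move=> mA; rewrite (_ : mkset _ =
    \bigcap_(i : 'I_n) ((fun v : 'rV[R]_n => v ord0 i) @^-1` A i)); last first.
  by apply/seteqP; split => [v Av i _|v Av i]; [exact: Av|exact: (Av i)].
rewrite -[X in measurable X]setCK setC_bigcap; apply: measurableC.
apply: countable_bigcupT_measurable; first exact: countableP.
move=> i; have := measurable_coord_rV i measurableT (mA i).
by rewrite setTI; exact: measurableC.
Qed.

Lemma lebesgue_rV_box n (A : 'I_n -> set (measurableTypeR R)) :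
  (forall i, measurable (A i)) ->
  lebesgue_rV n [set v | forall i, A i (v ord0 i)] =
  (\prod_i @lebesgue_measure R (A i))%E.
Proof.
elim: n A => [|n IH] A mA.
  by rewrite big_ord0 /= diracE mem_set// => -[].
rewrite big_ord_recl /= /prepend_lebesgue /pushforward.
rewrite -(IH (fun i => A (lift ord0 i)))// -product_measure1E//; last first.
  exact: (@measurable_box_rV _ (fun i => A (lift ord0 i)) (fun i => mA _)).
congr (_ _); apply/seteqP; split => [p pA|p [p1 p2] i] /=.
  split=> [|i]; first by have := pA ord0; rewrite cons_rV0.
  by have := pA (lift ord0 i); rewrite cons_rVS.
by have [j ->|->] := unliftP ord0 i; rewrite ?cons_rVS ?cons_rV0//; exact: p2.
Qed.

End lebesgue_rV.

Section random_sets.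
Context (R : realType) (n : nat) (D : set 'rV[R]_n).

(* The library norm on 'rV[R]_n is the sup norm; the topology is the same. *)
Definition euclidean_norm (y : 'rV[R]_n) : R :=
  Num.sqrt (\sum_i y ord0 i ^+ 2).

Definition rel_closed : set (set 'rV[R]_n) :=
  [set F | exists2 C, closed C & F = D `&` C].

Definition rel_open : set (set 'rV[R]_n) :=
  [set G | exists2 U, open U & G = D `&` U].

Definition closed_hitting (G : set 'rV[R]_n) : set (set 'rV[R]_n) :=
  [set F | rel_closed F /\ F `&` G !=set0].

(* The sigma-algebra lives on the set rel_closed, not on all of set 'rV_n. *)
Definition closed_sets_sigma_algebra : set (set (set 'rV[R]_n)) :=
  <<s rel_closed, [set closed_hitting G | G in rel_open] >>.

(* 0%E makes the supremum over the empty set 0 (norms are nonnegative). *)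
Definition sup_norm (A : set 'rV[R]_n) : \bar R :=
  ereal_sup (0%E |` [set (euclidean_norm y)%:E | y in A]).

Context d (T : measurableType d) (P : probability T R).

Definition random_set (X : T -> set 'rV[R]_n) : Prop :=
  (forall w, rel_closed (X w)) /\
  (forall G, rel_open G -> measurable [set w | X w `&` G !=set0]).

Definition integrally_bounded (X : T -> set 'rV[R]_n) : Prop :=
  (\int[P]_w sup_norm (X w) < +oo)%E.

Definition independent_point_set (x : T -> 'rV[R]_n)
    (X : T -> set 'rV[R]_n) : Prop :=
  forall B S, measurable B -> closed_sets_sigma_algebra S ->
    P (x @^-1` B `&` X @^-1` S) = (P (x @^-1` B) * P (X @^-1` S))%E.

End random_sets.

Section densities.
Context (R : realType) (n : nat) d (T : measurableType d).

(* xi w = None means that the random vector is undefined at w, so the law of xi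
   under Q is B |-> Q (xi @^-1` (Some @` B)). Densities are taken with respect
   to Lebesgue measure on D. *)
Definition has_density (Q : set T -> \bar R) (D : set 'rV[R]_n)
    (xi : T -> option 'rV[R]_n) (f : 'rV[R]_n -> R) : Prop :=
  [/\ forall B, measurable B -> measurable (xi @^-1` (Some @` B)),
      measurable_fun D f,
      forall y, D y -> 0 <= f y &
      forall B, measurable B -> B `<=` D ->
        Q (xi @^-1` (Some @` B)) = (\int[lebesgue_rV R n]_(y in B) (f y)%:E)%E].

End densities.

Section posterior.
Context (R : realType) (n m : nat) d (T : measurableType d).
Context (P : probability T R) (D : set 'rV[R]_n).

(* h stands for a map defined on D: its values outside D are not used. *)
Definition measurement_set (h : 'rV[R]_n -> 'rV[R]_m) (eps : T -> 'rV[R]_m)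
    (Z : set 'rV[R]_m) (w : T) : set 'rV[R]_n :=
  [set y | D y /\ Z (h y + eps w)].

Definition posterior (x : T -> 'rV[R]_n) (X : T -> set 'rV[R]_n) (w : T) :
    option 'rV[R]_n :=
  if `[< X w (x w) >] then Some (x w) else None.

Definition posterior_measure (xa : T -> option 'rV[R]_n) (B : set T) : \bar R :=
  ((\int[P]_(w in B) (\1_[set w | xa w <> None] w)%:E) /
   (\int[P]_w (\1_[set w | xa w <> None] w)%:E))%E.

Definition likelihood (X : T -> set 'rV[R]_n) (y : 'rV[R]_n) : R :=
  \int[P]_w \1_(X w) y.

Definition posterior_density (prior : 'rV[R]_n -> R) (X : T -> set 'rV[R]_n)
    (y : 'rV[R]_n) : R :=
  prior y * likelihood X y /
  \int[lebesgue_rV R n]_(z in D) (prior z * likelihood X z).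

End posterior.

(* Main.v *)
(* The joint law of (w, x w) is a measure on the product of T and R^n which, by
   independence and Dynkin's pi-lambda theorem, equals P times the prior on the
   sigma-algebra generated by the rectangles E x B with E an event of the random
   set X and B Borel. The graph {(w, y) | y in X w} belongs to this
   sigma-algebra: for X w closed, y is outside X w iff some rational ball
   contains y and misses X w. Hence P (x in B, x in X) is the integral over B of
   the prior times P (y in X), and dividing by P (x in X) gives the density. *)
From HB Require Import structures.
Require Import Defs.
From mathcomp Require Import all_boot all_order all_algebra.
From mathcomp Require Import all_classical all_reals all_analysis.
From mathcomp Require Import measurable_realfun.

Set Implicit Arguments.
Unset Strict Implicit.
Unset Printing Implicit Defensive.

Import Order.TTheory GRing.Theory Num.Theory.
Import numFieldNormedType.Exports.

Local Open Scope classical_set_scope.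
Local Open Scope ring_scope.

(** * The product of [P] with the measure of density [f] on [D] *)

Section density_product.
Context (R : realType) d1 d2 (T : measurableType d1) (U : measurableType d2).
Context (P : probability T R) (mu : {measure set U -> \bar R}).
Context (D : set U) (f : U -> R).
Context (mD : measurable D) (mf : measurable_fun D f).
Context (f0 : forall y, D y -> 0 <= f y).

(* The unused arguments carry the hypotheses of the measure instance below. *)
Definition density_product (_ : measurable D) (_ : measurable_fun D f)
    (_ : forall y, D y -> 0 <= f y) (C : set (T * U)) : \bar R :=
  (\int[mu]_(y in D) ((f y)%:E * P (ysection C y)))%E.

Let nu := density_product mD mf f0.

Let nu_set0 : nu set0 = 0%E.
Proof.
rewrite /nu /density_product integral0_eq// => y _.
by rewrite ysection0 measure0 mule0.
Qed.

Let nu_ge0 C : (0 <= nu C)%E.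
Proof.
by apply: integral_ge0 => y Dy; rewrite mule_ge0 ?lee_fin ?f0.
Qed.

Let nu_sigma_additive : semi_sigma_additive nu.
Proof.
move=> F mF tF mUF; rewrite [X in _ --> X](_ : _ = \sum_(i <oo) nu (F i))%E.
  by apply: is_cvg_ereal_nneg_natsum => i _; exact: nu_ge0.
(* Monotone convergence moves the series under the integral; the sections at [y] stay disjoint, so
   countable additivity of [P] finishes. *)
rewrite -integral_nneseries//.
- apply: eq_integral => y /set_mem Dy; rewrite ysection_bigcup.
  rewrite measure_semi_bigcup.
  + by rewrite nneseriesZl.
  + by move=> i; exact: measurable_ysection.
  + exact: trivIset_ysection.
  + by apply: bigcup_measurable => i _; exact: measurable_ysection.
- move=> i; apply: emeasurable_funM; first exact/measurable_EFinP.
  by apply: measurable_funTS; exact: measurable_fun_ysection.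
- by move=> i y Dy; rewrite mule_ge0 ?lee_fin ?f0.
Qed.

HB.instance Definition _ := isMeasure.Build _ _ _ (density_product mD mf f0)
  nu_set0 nu_ge0 nu_sigma_additive.

End density_product.

(** * Joint law of a random variable and the events independent of it *)

(** The first sides range over [F] only, since independence is available for those events alone. *)
Definition rectangles d1 d2 (T : measurableType d1) (U : measurableType d2)
    (F : set (set T)) : set (set (T * U)) :=
  [set E `*` B | E in F & B in measurable].

Lemma independent_joint_law (R : realType) d1 d2 (T : measurableType d1)
    (U : measurableType d2) (P : probability T R)
    (mu : {measure set U -> \bar R}) (D : set U) (f : U -> R) (x : T -> U)
    (F : set (set T)) :
  measurable D -> measurable_fun D f -> (forall y, D y -> 0 <= f y) ->
  measurable_fun setT x -> F `<=` measurable -> setI_closed F -> F setT ->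
  (forall E B, F E -> measurable B ->
    P (x @^-1` B `&` E) = ((\int[mu]_(y in B `&` D) (f y)%:E) * P E)%E) ->
  forall C, <<s rectangles F >> C ->
    P [set w | C (w, x w)] =
    (\int[mu]_(y in D) ((f y)%:E * P (ysection C y)))%E.
Proof.
move=> mD mf f0 mx mF IF FT indep.
have mg : measurable_fun setT (fun w : T => (w, x w)).
  exact: measurable_fun_pair.
pose g : {mfun T >-> (T * U)%type} :=
  HB.pack (fun w => (w, x w)) (isMeasurableFun.Build _ _ _ _ _ mg).
(* The constant sequence [setT] is the exhaustion required for uniqueness: it is a rectangle because
   [F setT], and it has finite mass under the law of [g]. *)
apply: (@g_sigma_algebra_measure_unique _ _ _ (rectangles F) _
  (fun=> setT) _ _ (pushforward P g) (density_product P mu mD mf f0)).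
- by move=> _ [E FE [B mB <-]]; apply: measurableX => //; exact: mF.
- by move=> _; exists setT => //; exists setT => //; rewrite setXTT.
- by rewrite bigcup_const//; exists 0.
- move=> _ _ [E FE [B mB <-]] [E' FE' [B' mB' <-]].
  rewrite -setXI; exists (E `&` E'); first exact: IF.
  by exists (B `&` B') => //; exact: measurableI.
- move=> _ [E FE [B mB <-]]; rewrite /density_product.
  rewrite [LHS](_ : _ = P (x @^-1` B `&` E)); last first.
    by congr (P _); apply/seteqP; split => w [].
  (* The section of [E]*[B] at [y] is [E] for [y] in [B] and empty otherwise, so the factor [P E]
     can enter the integral over [D]. *)
  rewrite indep// setIC integral_mkcondr.
  rewrite -ge0_integralZr//.
  + apply: eq_integral => y _; rewrite patchE; case: ifPn => yB.
      by rewrite in_ysectionX.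
    by rewrite notin_ysectionX// measure0 mule0 mul0e.
  + apply/measurable_restrict => //.
    apply/measurable_EFinP.
    exact: measurable_funS mf.
  + by move=> y Dy; rewrite patchE; case: ifP => // _; rewrite lee_fin f0.
- by move=> _; rewrite /= /pushforward preimage_setT probability_setT ltry.
Qed.

(** * Measurability of the graph of a random closed set *)

Lemma graph_rectangles (R : realType) (n : nat) (D : set 'rV[R]_n) d
    (T : measurableType d) (X : T -> set 'rV[R]_n) (F : set (set T)) :
  measurable D -> (forall w, rel_closed D (X w)) -> F setT -> setC_closed F ->
  (forall G, rel_open D G -> F [set w | X w `&` G !=set0]) ->
  <<s rectangles F >> [set p | X p.1 p.2].
Proof.
move=> mD clX FT FC hitF.
pose b (p : 'rV[rat]_n * nat) : set 'rV[R]_n :=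
  ball (map_mx ratr p.1 : 'rV[R]_n) (p.2.+1%:R^-1).
have ob p : open (b p) by exact: ball_open.
have rectF E B : F E -> measurable B -> <<s rectangles F >> (E `*` B).
  by move=> FE mB; apply: sub_sigma_algebra; exists E => //; exists B.
(* Removed from the cylinder over [D] are countably many rectangles: the event that [X] misses a
   rational ball, times that ball. *)
have -> : [set p | X p.1 p.2] = (setT `*` D) `\`
    \bigcup_p ((~` [set w | X w `&` (D `&` b p) !=set0]) `*` b p).
  apply/seteqP; split=> [[w y] /= Xwy|[w y] /= [[_ Dy] nXb]].
    have [C _ XC] := clX w.
    have Dy : D y by move: Xwy; rewrite XC => -[].
    by split=> // -[p _ /= [+ by_]]; apply; exists y.
  have [C cC XC] := clX w; rewrite XC; split => //.
  (* If [y] is not in [C], some rational ball around [y] lies in the complement of [C]; it misses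
     [X w], so [(w, y)] was removed. *)
  apply: contrapT => nCy; have : (~` C) y by [].
  rewrite (open_rV_countable (closed_openC cC)) => -[p /= pC py].
  apply: nXb; exists p => //; split => //= -[z []].
  by rewrite XC => -[_ Cz] [_ /pC].
apply: (@measurableD _ (g_sigma_algebraType (rectangles F))).
  exact: rectF.
apply: (@countable_bigcupT_measurable _ (g_sigma_algebraType (rectangles F))).
  exact: countableP.
move=> p; apply: rectF; last exact: open_measurable_rV.
by apply: FC; apply: hitF; exists (b p).
Qed.

(** Intersecting with [measurable] builds in that these preimages are events, so measurability has
    to be checked only on the hitting sets. *)
Definition random_set_events (R : realType) (n : nat) (D : set 'rV[R]_n) d
    (T : measurableType d) (X : T -> set 'rV[R]_n) : set (set T) :=
  measurable `&`
  [set X @^-1` S | S in closed_sets_sigma_algebra D].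

Lemma sigma_algebra_random_set_events (R : realType) (n : nat)
    (D : set 'rV[R]_n) d (T : measurableType d) (X : T -> set 'rV[R]_n) :
  (forall w, rel_closed D (X w)) ->
  sigma_algebra setT (random_set_events D X).
Proof.
move=> clX; split.
- split; first exact: measurable0.
  by exists set0; [exact: sigma_algebra0|rewrite preimage_set0].
- move=> E [mE [S sS SE]]; split; first exact: measurableD.
  (* Complements are relative to [rel_closed D]; this gives the right preimage because every [X w]
     is relatively closed. *)
  exists (rel_closed D `\` S); first exact: sigma_algebraCD.
  by rewrite -SE; apply/seteqP; split => [w [_]|w [_ nS]].
- move=> E FE; split; first by apply: bigcupT_measurable => i; exact: (FE i).1.
  have /choice[S SE] i :
      exists S, closed_sets_sigma_algebra D S /\ X @^-1` S = E i.
    by have [_ [S sS SE]] := FE i; exists S.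
  exists (\bigcup_i S i).
    by apply: sigma_algebra_bigcup => i; exact: (SE i).1.
  by rewrite preimage_bigcup; apply: eq_bigcupr => i _; exact: (SE i).2.
Qed.

(** * Bayes' formula for a random closed set *)

(** Numerator and normalising constant come from the same identity [jointE], taken at [B] and at
    [D]. *)
Lemma posterior_has_density (R : realType) d (T : measurableType d)
    (P : probability T R) (n : nat) (D : set 'rV[R]_n)
    (x : {RV P >-> 'rV[R]_n}) (prior : 'rV[R]_n -> R) (X : T -> set 'rV[R]_n) :
  measurable D -> (forall w, D (x w)) ->
  has_density P D (fun w => Some (x w)) prior ->
  random_set D X -> independent_point_set D P x X ->
  (0 < P [set w | X w (x w)])%E ->
  has_density (posterior_measure P (posterior x X)) D (posterior x X)
    (posterior_density P D prior X).
Proof.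
move=> mD Dx [_ mprior prior0 priorE] [clX mX] indep PH0.
pose F := random_set_events D X.
have sF : sigma_algebra setT F by exact: sigma_algebra_random_set_events.
have [F0 FC _] := sF.
have FT : F setT by rewrite -(setD0 setT); exact: FC.
have IF : setI_closed F by have /sigma_algebraP[] := sF.
have mF : F `<=` measurable by move=> E [].
pose A := [set p : T * 'rV[R]_n | X p.1 p.2].
have sA : <<s rectangles F >> A.
  apply: (@graph_rectangles _ _ D) => //.
    by move=> E FE; rewrite -setTD; exact: FC.
  move=> G oG; split; first exact: mX.
  exists (closed_hitting D G); first by apply: sub_sigma_algebra; exists G.
  by apply/seteqP; split => [w []|w] //; split.
have mrect : rectangles F `<=` (measurable : set (set (T * 'rV[R]_n))).
  by move=> _ [E FE [B mB <-]]; apply: measurableX => //; exact: mF.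
have mA : measurable A.
  by apply: (smallest_sub _ mrect) sA; exact: sigma_algebra_measurable.
pose H := [set w | X w (x w)].
have mx : measurable_fun setT x by exact: measurable_funP.
have mxB B : measurable B -> measurable (x @^-1` B).
  by move=> mB; rewrite -[X in measurable X]setTI; exact: mx.
have mH : measurable H.
  rewrite -[H]setTI.
  exact: (measurable_fun_pair (@measurable_id _ _ setT) mx) measurableT _ mA.
(* The likelihood is the probability of a section of the graph, hence finite and, by measurability
   of [A], measurable in [y]. *)
have likelihoodE y : (likelihood P X y)%:E = P (ysection A y).
  have mAy : measurable (ysection A y) by exact: measurable_ysection.
  have intE : (\int[P]_w (\1_(X w) y)%:E)%E = P (ysection A y).
    rewrite -(setIT (ysection A y)) -integral_indic//.
    apply: eq_integral => w _; congr EFin.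
    rewrite !indicE; congr ((nat_of_bool _)%:R).
    by apply/idP/idP => /set_mem; rewrite ysectionE => ?; exact/mem_set.
  by rewrite /likelihood /Rintegral intE fineK ?fin_num_measure.
have L0 y : 0 <= likelihood P X y by rewrite -lee_fin likelihoodE.
have mL : measurable_fun setT (likelihood P X).
  apply/measurable_EFinP; rewrite (_ : _ \o _ = P \o ysection A).
    exact: measurable_fun_ysection.
  by apply/funext => y /=; rewrite likelihoodE.
have jointE B : measurable B -> B `<=` D ->
    P (x @^-1` B `&` H) =
    (\int[lebesgue_rV R n]_(y in B) (prior y * likelihood P X y)%:E)%E.
  move=> mB BD.
  (* The joint law is evaluated on the part of the graph over [B], whose sections are those of [A]
     for [y] in [B] and empty otherwise. *)
  have := @independent_joint_law R _ _ T 'rV[R]_n P (lebesgue_rV R n) D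
    prior x F mD mprior prior0 mx mF IF FT _ (setT `*` B `&` A).
  rewrite [X in P X](_ : _ = x @^-1` B `&` H); last first.
    by apply/seteqP; split => w [] // [].
  move=> ->.
  - rewrite -[in RHS](setIidr BD) integral_mkcondr; apply: eq_integral => y _.
    rewrite patchE ysectionI; case: ifPn => yB.
      by rewrite in_ysectionX// setTI -likelihoodE EFinM.
    by rewrite notin_ysectionX// set0I measure0 mule0.
  - move=> E B' [_ [S sS <-]] mB'.
    rewrite indep//; congr (_ * _)%E.
    (* [priorE] speaks of Borel subsets of [D]; replacing [B'] by its trace on [D] keeps the event,
       as [x] has values in [D]. *)
    rewrite -priorE; [|exact: measurableI|exact: subIsetr].
    congr (P _); apply/seteqP; split => w /=.
      by move=> B'xw; exists (x w).
    by move=> [y [B'y _] [yx]]; rewrite -yx.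
  - apply: (@measurableI _ (g_sigma_algebraType (rectangles F))) => //.
    by apply: sub_sigma_algebra; exists setT => //; exists B.
have mpL : measurable_fun D (fun y => prior y * likelihood P X y).
  by apply: measurable_funM => //; exact: measurable_funTS.
have pL0 y : D y -> 0 <= prior y * likelihood P X y.
  by move=> Dy; rewrite mulr_ge0// prior0.
have PHE :
    P H = (\int[lebesgue_rV R n]_(z in D) (prior z * likelihood P X z))%:E.
  rewrite /Rintegral -jointE// fineK ?fin_num_measure//; last first.
    by apply: measurableI => //; exact: mxB.
  by congr (P _); apply/seteqP; split => w //; [split => //; exact: Dx|case].
set c := \int[_]_(z in D) _ in PHE.
have c0 : 0 < c by rewrite -lte_fin -PHE.
have defE : [set w | posterior x X w <> None] = H.
  by apply/seteqP; split => w; rewrite /= /posterior; case: asboolP.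
(* A value [Some y] of the posterior already forces [w] into [H]. *)
have evE B : posterior x X @^-1` (Some @` B) = x @^-1` B `&` H.
  apply/seteqP; split => w; rewrite /= /posterior; case: asboolP => //.
  - by move=> Hw [y By [<-]].
  - by move=> _ [].
  - by move=> Hw [Bx _]; exists (x w).
  - by move=> nHw [_ /nHw].
split.
- by move=> B mB; rewrite evE; apply: measurableI => //; exact: mxB.
- by apply: measurable_funM => //.
- by move=> y Dy; rewrite /posterior_density -/c divr_ge0// ?pL0// ltW.
- move=> B mB BD; rewrite evE /posterior_measure defE.
  have mBH : measurable (x @^-1` B `&` H).
    by apply: measurableI => //; exact: mxB.
  have -> : (\int[P]_w (\1_H w)%:E = c%:E)%E by rewrite integral_indic// setIT.
  rewrite integral_indic// setIidr; last exact: subIsetr.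
  (* Since [c] is positive, its inverse in the extended reals is the real one, and it moves under
     the integral as a constant factor. *)
  rewrite [X in (X / _)%E]jointE// inver gt_eqF// -ge0_integralZr//.
  + by apply/measurable_EFinP; exact: measurable_funS mpL.
  + by move=> y By; rewrite lee_fin pL0//; exact: BD.
  + by rewrite lee_fin invr_ge0 ltW.
Qed.

Theorem theorem1 (R : realType) (d : measure_display) (T : measurableType d)
    (P : probability T R) (n m : nat) (D : set 'rV[R]_n)
    (x : {RV P >-> 'rV[R]_n}) (prior : 'rV[R]_n -> R)
    (h : 'rV[R]_n -> 'rV[R]_m) (eps : {RV P >-> 'rV[R]_m})
    (Z : set 'rV[R]_m) :
  let Xd := measurement_set D h eps Z in
  let xa := posterior x Xd in
  measure_is_complete P ->
  measurable D ->
  (forall w, D (x w)) ->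
  P.-integrable setT (fun w => (euclidean_norm (x w))%:E) ->
  has_density P D (fun w => Some (x w)) prior ->
  random_set D Xd ->
  integrally_bounded P Xd ->
  {ae P, forall w, Xd w = D `&` closure (Xd w)°} ->
  independent_point_set D P x Xd ->
  (0 < P [set w | Xd w (x w)])%E ->
  has_density (posterior_measure P xa) D xa (posterior_density P D prior Xd).
Proof.
move=> Xd xa _ mD Dx _ priorP XdP _ _ indep XdP0.
exact: posterior_has_density.
Qed.
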